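(* Let $P\in CM_n$ be an element of the Connection Monoid on $n$ strands. Consider the sequence of powers $P,P^2,P^3,\dots$. Then there exists an integer $N\ge 1$ such that $P,P^2,\dots,P^N$ are distinct but $P\,P^N=\delta^kP^N$ for some integer $k\ge 0$, where $\delta$ is the loop value in the monoid, corresponding to the occurrence of a closed loop.
   Context: **Connection Monoid.** Consider two rows of nodes, the top row $1,2,\dots,n$ and the bottom row $1',2',\dots,n'$. A pairing is a partition of these $2n$ nodes into two-element sets (top-top, top-bottom or bottom-bottom). A pairing is planar if it can be represented by a collection of arcs embedded in the planar strip between the two rows, joining paired nodes, with no crossings between arcs and no self-crossings. The elements of the Connection Monoid $CM_n$ are the formal expressions $\delta^m a$ with $m\ge 0$ an integer and $a$ a planar pairing; two elements are equal exactly when they have the same exponent $m$ and the same set of pairs. The product of pairings $ab$ is formed by attaching the bottom row of $a$ to the top row of $b$ (identifying $j'$ of $a$ with $j$ of $b$), eliminating the middle nodes to obtain a new pairing of the outer nodes, and multiplying by $\delta^{\ell}$, where $\ell$ is the number of closed loops formed in the middle; $\delta$ is central. The identity is the pairing $\{(k,k') : 1\le k\le n\}$. *)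

(* Defs.v *)
From HB Require Import structures.
From mathcomp Require Import all_boot all_order all_algebra.
From mathcomp Require Import all_classical all_reals all_analysis.
Import numFieldNormedType.Exports.

Set Implicit Arguments.
Unset Strict Implicit.
Unset Printing Implicit Defensive.

Import Order.TTheory GRing.Theory Num.Theory.

Local Open Scope classical_set_scope.
Local Open Scope ring_scope.

(* [inl i] is the [i]-th node of the top row, [inr i] the one below it in the
   bottom row; strands are numbered from 0. *)
Definition node (n : nat) : finType := ('I_n + 'I_n)%type.

Definition is_pairing n (a : {set {set node n}}) : bool :=
  finset.partition a [set: node n]%SET && [forall B in a, #|B| == 2%N].

(* The strip is R x [0, 1], with the top row at height 1. *)
Definition node_pos (R : realType) n (x : node n) : R * R :=
  match x with inl i => (i%:R, 1) | inr i => (i%:R, 0) end.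

(* [g B] parametrizes, over [0, 1], the arc that joins the two nodes of [B]. *)
Definition planar (R : realType) n (a : {set {set node n}}) : Prop :=
  exists g : {set node n} -> R -> R * R,
    (forall B, B \in a ->
      [/\ {within `[0, 1], continuous (g B)},
          {in `[0, 1] &, injective (g B)},
          {in `[0, 1], forall t, 0 <= (g B t).2 <= 1} &
          [set g B 0; g B 1] = [set node_pos R x | x in [set` B]]])
    /\ (forall B C, B \in a -> C \in a -> B != C ->
          g B @` `[0, 1] `&` g C @` `[0, 1] = set0).

(* The formal expression delta^exponent . pairs. It is an element of CM_n only
   when [pairs] is a planar pairing, see [CM]. *)
Record expr (n : nat) := Expr {
  exponent : nat;
  pairs : {set {set node n}}
}.

Definition CM (R : realType) n (P : expr n) : Prop :=
  is_pairing (pairs P) /\ planar R (pairs P).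

(* Stacking [a] on top of [b]: in the glued diagram [inl x] is the outer node
   [x], and [inr j] is the bottom node [j] of [a] identified with the top node
   [j] of [b]. *)
Definition glued_node (n : nat) : finType := (node n + 'I_n)%type.

Definition upper n (x : node n) : glued_node n :=
  match x with inl i => inl (inl i) | inr j => inr j end.

Definition lower n (x : node n) : glued_node n :=
  match x with inl j => inr j | inr i => inl (inr i) end.

Definition glued_arcs n (a b : {set {set node n}}) : {set {set glued_node n}} :=
  ([set @upper n @: B | B : {set node n} in a]
   :|: [set @lower n @: B | B : {set node n} in b])%SET.

Definition joined n (a b : {set {set node n}}) : rel (glued_node n) :=
  fun x y => [exists E in glued_arcs a b, (x \in E) && (y \in E)].

Definition strands n (a b : {set {set node n}}) : {set {set glued_node n}} :=
  [set [set y | connect (joined a b) x y]%SET | x : glued_node n]%SET.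

Definition outer_nodes n (S : {set glued_node n}) : {set node n} :=
  (inl @^-1: S)%SET.

Definition glued_pairs n (a b : {set {set node n}}) : {set {set node n}} :=
  ([set outer_nodes S | S in strands a b] :\ finset.set0)%SET.

(* The closed loops are the strands that lie entirely in the middle row. *)
Definition loops n (a b : {set {set node n}}) : nat :=
  #|[set S in strands a b | outer_nodes S == finset.set0]%SET|.

Definition expr_mul n (P Q : expr n) : expr n :=
  Expr (exponent P + exponent Q + loops (pairs P) (pairs Q))%N
       (glued_pairs (pairs P) (pairs Q)).

Definition expr_one n : expr n :=
  Expr 0 [set [set inl k; inr k]%SET | k : 'I_n]%SET.

HB.instance Definition _ n := hasMul.Build (expr n) (@expr_mul n).
HB.instance Definition _ n := hasOne.Build (expr n) (expr_one n).

(* delta^k . P *)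
Definition delta_scale n (k : nat) (P : expr n) : expr n :=
  Expr (k + exponent P)%N (pairs P).

(* Main.v *)
Require Import Defs.
From mathcomp Require Import all_boot all_order all_algebra.
From mathcomp Require Import all_classical all_reals all_analysis.
From mathcomp Require Import ring lra zify.

(** Planarity of a pairing enters only through a parity: for two disjoint arcs in the strip, the
    number of pairs (end of the first, end of the second) lying on the same row, the first to the
    right of the second, is even. This is read off from the winding number of
    [(s, t) |-> f s - g t] along the boundary of the unit square, which vanishes because the map
    avoids the origin. The parity is additive over the arcs that make up a strand, the contributions
    of the middle row cancelling in pairs, so it passes to products.

    In [P^(m+1) = P * P^m] the top-top and the bottom-bottom pairs can only increase with [m], hence
    they stabilize; the parity condition forces the remaining strands to preserve the order, so
    they are then determined, and the underlying pairing is eventually constant. The least [N] at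
    which it repeats is the required one. *)

Set Implicit Arguments.
Unset Strict Implicit.
Unset Printing Implicit Defensive.

(** * Disjoint arcs in the strip *)

Section DisjointArcs.
Import numFieldNormedType.Exports Order.TTheory GRing.Theory Num.Theory.
Local Open Scope classical_set_scope.
Local Open Scope ring_scope.

Definition upper_half (R : realDomainType) (p : R * R) : bool := 0 <= p.2.

Definition right_half (R : realDomainType) (p : R * R) : bool := 0 < p.1.

(* For nearby points away from the origin: the segment from [p] to [q] meets the ray [x > 0, y = 0],
   counted mod 2. *)
Definition crosses (R : realDomainType) (p q : R * R) : bool :=
  (upper_half p (+) upper_half q) && right_half p.

(** On the half-plane y <= 0 this singles out the open ray x > 0, y = 0. *)
Definition on_ray (R : realDomainType) (p : R * R) : bool :=
  upper_half p && right_half p.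

Definition nearby (R : realDomainType) (e : R) (p q : R * R) : bool :=
  (`|p.1 - q.1| < e) && (`|p.2 - q.2| < e).

Definition far (R : realDomainType) (e : R) (p : R * R) : bool :=
  (e <= `|p.1|) || (e <= `|p.2|).

(** * Winding number mod 2 on a grid *)

Section Discrete.
Variables (R : realFieldType) (e : R).
Implicit Types p q : R * R.
Local Notation nearby := (nearby e).
Local Notation far := (far e).

Lemma nearbyP p q : reflect
  [/\ p.1 - q.1 < e, q.1 - p.1 < e, p.2 - q.2 < e & q.2 - p.2 < e] (nearby p q).
Proof.
rewrite /nearby !ltr_norml; apply: (iffP idP).
  by move=> /andP[/andP[? ?] /andP[? ?]]; split; lra.
by case=> ? ? ? ?; apply/andP; split; apply/andP; split; lra.
Qed.

Lemma far_level p : far p -> - e < p.2 < e -> (e <= p.1) || (p.1 <= - e).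
Proof.
rewrite /far -ltr_norml => /orP[|/le_lt_trans/[apply]]; last by rewrite ltxx.
by rewrite lerNr ler_normr.
Qed.

Lemma right_half_nearby p q : far p -> far q -> nearby p q ->
  - e < p.2 < e -> - e < q.2 < e -> right_half p = right_half q.
Proof.
rewrite /right_half => fp fq /nearbyP[h1 h2 _ _] hp hq.
have {}fp := far_level fp hp; have {}fq := far_level fq hq.
case/andP: hp => hp _.
case/orP: fp; case/orP: fq => h3 h4; apply/idP/idP => h5; lra.
Qed.

Lemma nearbyC p q : nearby p q = nearby q p.
Proof. by rewrite /nearby distrC [X in _ && (X < _)]distrC. Qed.

Lemma straddle_level p q : nearby p q -> upper_half q != upper_half p ->
  - e < p.2 < e /\ - e < q.2 < e.
Proof.
move=> /nearbyP[_ _ h1 h2]; rewrite /upper_half.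
by case: (lerP 0 p.2); case: (lerP 0 q.2) => //= hq hp _;
  split; apply/andP; split; lra.
Qed.

Lemma straddle_level3 p q r : upper_half q != upper_half p -> nearby p r -> nearby q r ->
  - e < r.2 < e.
Proof.
move=> pq pr qr; have [rp|rp] := eqVneq (upper_half r) (upper_half p).
  by have [] : _ /\ - e < r.2 < e := straddle_level qr _; rewrite // rp eq_sym.
by have [] := straddle_level pr rp.
Qed.

(** If the four corners agree on [upper_half], every term is false. Otherwise two of them straddle
    the axis, so all four have height less than [e] in absolute value; being far from the origin and
    near each other, they agree on [right_half]. Then [crosses] is a coboundary and cancels around
    the cell. *)
Lemma crosses_cell p q p' q' :
  far p -> far q -> far p' -> far q' ->
  nearby p q -> nearby p p' -> nearby p q' -> nearby q p' -> nearby q q' ->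
  nearby p' q' ->
  crosses p q (+) crosses p' q' = crosses p p' (+) crosses q q'.
Proof.
move=> fp fq fp' fq' c1 c2 c3 c4 c5 c6; rewrite /crosses.
suff [[hq hp' hq']|[hq hp' hq']] :
  [/\ upper_half q = upper_half p, upper_half p' = upper_half p &
      upper_half q' = upper_half p] \/
  [/\ right_half q = right_half p, right_half p' = right_half p &
      right_half q' = right_half p].
- by rewrite hq hp' hq' addbb.
- rewrite hq hp'; by case: (upper_half p) (upper_half q) (upper_half p') (upper_half q')
    (right_half p) => [] [] [] [] [].
have [h|h] := boolP [|| upper_half q != upper_half p,
    upper_half p' != upper_half p | upper_half q' != upper_half p]; last first.
  by left; move: h; rewrite !negb_or !negbK => /and3P[/eqP-> /eqP-> /eqP->].
right.
have [hp hq hp' hq'] : [/\ - e < p.2 < e, - e < q.2 < e, - e < p'.2 < e &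
    - e < q'.2 < e].
  case/or3P: h => h.
  - have [lp lq] := straddle_level c1 h.
    by split=> //; apply: (straddle_level3 h).
  - have [lp lp'] := straddle_level c2 h.
    by split=> //; apply: (straddle_level3 h); rewrite // nearbyC.
  - have [lp lq'] := straddle_level c3 h.
    by split=> //; apply: (straddle_level3 h); rewrite // nearbyC.
by split; apply/esym/right_half_nearby.
Qed.

Lemma crosses_upper p q : 0 <= p.2 -> 0 <= q.2 -> crosses p q = false.
Proof. by rewrite /crosses /upper_half => -> ->. Qed.

(** [upper_half] is closed, so where y <= 0 it holds only on the axis, and a crossing is a change of
    [on_ray]. Sums along an edge that stays there thus telescope. *)
Lemma crosses_lower p q : far p -> far q -> nearby p q -> p.2 <= 0 -> q.2 <= 0 ->
  crosses p q = on_ray p (+) on_ray q.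
Proof.
move=> fp fq c hp hq; rewrite /crosses /on_ray /upper_half.
have [? ? ? ?] := nearbyP _ _ c.
case: (lerP 0 p.2) => h; case: (lerP 0 q.2) => h' //=.
- by rewrite (right_half_nearby fp fq c) ?addbb //; apply/andP; split; lra.
- by rewrite addbF.
- by rewrite (right_half_nearby fp fq c) //; apply/andP; split; lra.
Qed.

(** Discrete Stokes: adding [crosses_cell] over all cells cancels the inner edges mod 2. The index
    ranges of the second hypothesis include both diagonals of a cell. *)
Lemma crosses_grid (F : nat -> nat -> R * R) (N : nat) :
  (forall i j, (i <= N)%N -> (j <= N)%N -> far (F i j)) ->
  (forall i j i' j', (i <= i' <= i.+1)%N -> (i' <= N)%N ->
     (j' <= j.+1)%N -> (j <= j'.+1)%N -> (j <= N)%N -> (j' <= N)%N ->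
     nearby (F i j) (F i' j')) ->
  \big[addb/false]_(j < N) crosses (F 0 j) (F 0 j.+1) (+)
  \big[addb/false]_(j < N) crosses (F N j) (F N j.+1) =
  \big[addb/false]_(i < N) crosses (F i 0) (F i.+1 0) (+)
  \big[addb/false]_(i < N) crosses (F i N) (F i.+1 N).
Proof.
move=> farF nearbyF.
rewrite -!big_split /=.
have H : forall M, (M <= N)%N ->
  \big[addb/false]_(j < N) (crosses (F 0 j) (F 0 j.+1) (+)
     crosses (F M j) (F M j.+1)) =
  \big[addb/false]_(i < M) (crosses (F i 0) (F i.+1 0) (+)
     crosses (F i N) (F i.+1 N)).
  elim=> [|M IH] MN; first by rewrite big_ord0 big1 // => j _; rewrite addbb.
  rewrite big_ord_recr -IH 1?ltnW //=.
  have -> : crosses (F M 0) (F M.+1 0) (+) crosses (F M N) (F M.+1 N) =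
    \big[addb/false]_(j < N) (crosses (F M j) (F M j.+1) (+)
     crosses (F M.+1 j) (F M.+1 j.+1)).
    have : forall K, (K <= N)%N ->
       crosses (F M 0) (F M.+1 0) (+) crosses (F M K) (F M.+1 K) =
       \big[addb/false]_(j < K) (crosses (F M j) (F M j.+1) (+)
         crosses (F M.+1 j) (F M.+1 j.+1)).
      elim=> [|K IHK] KN; first by rewrite big_ord0 addbb.
      rewrite big_ord_recr -IHK 1?ltnW //=.
      have KN' := ltnW KN; have MN' := ltnW MN.
      have -> : crosses (F M K) (F M K.+1) (+) crosses (F M.+1 K) (F M.+1 K.+1) =
          crosses (F M K) (F M.+1 K) (+) crosses (F M K.+1) (F M.+1 K.+1).
        by apply: crosses_cell; rewrite ?farF //;
          apply: nearbyF; rewrite ?leqnn ?leqnSn ?leqW //= ?leqnSn.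
      by rewrite -addbA; congr (_ (+) _); rewrite addbA addbb.
    by move=> /(_ N (leqnn N)).
  rewrite -big_split; apply: eq_bigr => j _ /=.
  by rewrite -addbA; congr (_ (+) _); rewrite addbA addbb.
by rewrite (H N).
Qed.

Lemma crosses_sum_lower (F : nat -> R * R) (N : nat) :
  (forall i, (i <= N)%N -> far (F i)) ->
  (forall i, (i < N)%N -> nearby (F i) (F i.+1)) ->
  (forall i, (i <= N)%N -> (F i).2 <= 0) ->
  \big[addb/false]_(i < N) crosses (F i) (F i.+1) = on_ray (F 0) (+) on_ray (F N).
Proof.
elim: N => [|N IH] farF nearbyF lowF; first by rewrite big_ord0 addbb.
rewrite big_ord_recr /= IH.
- rewrite crosses_lower ?farF ?lowF ?nearbyF ?leqnSn //.
  by rewrite -addbA; congr (_ (+) _); rewrite addbA addbb.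
- by move=> i /leqW; apply: farF.
- by move=> i /leqW; apply: nearbyF.
- by move=> i /leqW; apply: lowF.
Qed.

Lemma crosses_sum_upper (F : nat -> R * R) (N : nat) :
  (forall i, (i <= N)%N -> 0 <= (F i).2) ->
  \big[addb/false]_(i < N) crosses (F i) (F i.+1) = false.
Proof. by move=> F0; apply: big1 => i _; rewrite crosses_upper ?F0 // ltnW. Qed.

End Discrete.

(** * Uniform estimates on compact sets *)

Lemma within_continuous_dist (R : realType) (V : normedModType R) (A : set R) (f : R -> V) :
  {within A, continuous f} -> forall x (e : R), A x -> 0 < e ->
  exists2 d, 0 < d & forall y, A y -> `|x - y| < d -> `|f x - f y| < e.
Proof.
move=> /subspace_continuousP cf x e Ax e0.
have /cvgrPdist_lt /(_ e e0) := cf x Ax.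
rewrite /prop_near1 /within /= => /nbhs_ballP[d /= d0 H]; exists d => // y Ay xy.
exact: H.
Qed.

Lemma compact_uniformly_continuous (R : realType) (V : normedModType R) (A : set R)
    (f : R -> V) : compact A -> {within A, continuous f} ->
  forall e : R, 0 < e -> exists2 d, 0 < d &
    forall s t, A s -> A t -> `|s - t| < d -> `|f s - f t| < e.
Proof.
move=> /compact_near_coveringP cA cf e e0.
pose P (d t : R) := A t -> forall s, A s -> `|s - t| < d -> `|f s - f t| < e.
have /cA : forall x, A x -> \forall x' \near x & d \near 0^'+, P d x'.
  move=> x Ax.
  have e2 : 0 < e / 2 by rewrite divr_gt0.
  have [d d0 H] := within_continuous_dist cf Ax e2.
  (* Half the radius: if [t] is within [d / 2] of [x] and [s] within [d / 2] of [t], both are within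
     [d] of [x]. *)
  exists (ball x (d / 2), [set r | r < d / 2]) => /=.
    split; first by apply: nbhsx_ballx; rewrite divr_gt0.
    by apply: nbhs_right_lt; rewrite divr_gt0.
  move=> [t r] [/= xt rd] At s As st; rewrite /ball /= in xt.
  rewrite [e]splitr -(subrKA (f x)); apply: le_lt_trans (ler_normD _ _) _.
  rewrite ltrD //; last by apply: H => //; lra.
  rewrite distrC; apply: H => //.
  have -> : x - s = (x - t) - (s - t) by ring.
  by apply: le_lt_trans (ler_normB _ _) _; lra.
move=> H.
have {H} [d] := filter_ex (filterI (nbhs_right_gt 0) H).
by case=> d0 Hd; exists d => // s t As At; apply: Hd.
Qed.

Lemma compact_disjoint_dist (R : realType) (V : normedModType R) (A : set R)
    (f g : R -> V) : compact A -> {within A, continuous f} -> {within A, continuous g} ->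
  f @` A `&` g @` A = set0 ->
  exists2 e, 0 < e & forall s t, A s -> A t -> e <= `|f s - g t|.
Proof.
move=> cA cf cg fg0.
have /compact_near_coveringP cAA := compact_setX cA cA.
pose P (d : R) (z : R * R) := A z.1 -> A z.2 -> d <= `|f z.1 - g z.2|.
have /cAA : forall z, (A `*` A) z -> \forall z' \near z & d \near 0^'+, P d z'.
  move=> [s t] [/= As At].
  (* A third of the distance: moving each point by less than this leaves more than a third. *)
  have fgst : 0 < `|f s - g t| / 3.
    rewrite divr_gt0 // normr_gt0 subr_eq0; apply/eqP => fE.
    suff : set0 (f s) by [].
    by rewrite -fg0; split; [exists s | rewrite fE; exists t].
  have [d1 d10 H1] := within_continuous_dist cf As fgst.
  have [d2 d20 H2] := within_continuous_dist cg At fgst.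
  exists (ball s d1 `*` ball t d2, [set r | r < `|f s - g t| / 3]) => /=.
    split; last exact: nbhs_right_lt.
    by exists (ball s d1, ball t d2) => //=; split; apply: nbhsx_ballx.
  move=> [[s' t'] r] /= [[ss tt] rd] /= As' At'.
  have {}H1 := H1 _ As' ss; have {}H2 := H2 _ At' tt.
  have := ler_normD (f s - f s' + (g t' - g t)) (f s' - g t').
  have -> : f s - f s' + (g t' - g t) + (f s' - g t') = f s - g t.
    by rewrite -addrA [g t' - g t + _]addrC !subrKA.
  have := ler_normD (f s - f s') (g t' - g t); rewrite (distrC (g t')).
  by lra.
move=> H; have [e] := filter_ex (filterI (nbhs_right_gt 0) H).
by case=> e0 He; exists e => // s t As At; apply: (He (s, t)).
Qed.

(** Nodes of different rows are never compared. Both rows use the same direction, so that the two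
    readings of a middle row agree when diagrams are stacked. *)
Definition right_of n (x y : node n) : bool :=
  match x, y with
  | inl i, inl j => (j < i)%N
  | inr i, inr j => (j < i)%N
  | _, _ => false
  end.

Lemma unit_grid_exists (R : realType) (d : R) : 0 < d ->
  exists u : nat -> R, exists2 N : nat, u 0 = 0 /\ u N = 1 &
    (forall i, (i <= N)%N -> u i \in `[0, 1]) /\
    (forall i j, (i <= j.+1)%N -> (j <= i.+1)%N -> `|u i - u j| < d).
Proof.
move=> d0; have dV0 : 0 <= d^-1 by rewrite invr_ge0 ltW.
have := archi_boundP dV0; set N := Num.bound _ => dN.
have N0 : (0 : R) < N%:R by apply: le_lt_trans dN.
have Nd : N%:R^-1 < d by rewrite invf_plt.
exists (fun i => i%:R / N%:R), N; first by rewrite mul0r divff ?gt_eqF.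
split=> [i iN|i j ij ji].
  by rewrite in_itv /= divr_ge0 //= ler_pdivrMr // mul1r ler_nat.
apply: le_lt_trans Nd; rewrite -mulrBl normrM [`|_^-1|]gtr0_norm ?invr_gt0 //.
apply: ler_piMl; first by rewrite invr_ge0 ltW.
rewrite ler_norml.
move: ij ji; rewrite -!(ler_nat R) -!natr1 => ij ji.
by apply/andP; split; lra.
Qed.

(** * Parity of two disjoint arcs *)

Section Linking.
Variables (R : realType) (f g : R -> R * R).
Hypotheses (cf : {within `[0, 1], continuous f}) (cg : {within `[0, 1], continuous g}).
Hypotheses (sf : {in `[0, 1], forall t, 0 <= (f t).2 <= 1})
           (sg : {in `[0, 1], forall t, 0 <= (g t).2 <= 1}).
Hypothesis fg0 : f @` `[0, 1] `&` g @` `[0, 1] = set0.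

Lemma far_norm (e : R) (p : R * R) : e <= `|p| -> far e p.
Proof. by rewrite prod_normE le_max. Qed.

Lemma nearby_norm (e : R) (p q : R * R) : `|p - q| < e -> nearby e p q.
Proof. by rewrite prod_normE gt_max. Qed.

(** The boundary sum of [crosses] for [f s - g t] vanishes. A side on which [f] is at a top node or
    [g] at a bottom node stays in [upper_half] and gives nothing; every other side gives [on_ray] at
    its two corners. Each corner whose nodes share a row is thus counted once, with value
    [right_of], and the other corners contribute nothing. *)
Lemma disjoint_arcs_unlinked n (x0 x1 y0 y1 : node n) :
  f 0 = node_pos R x0 -> f 1 = node_pos R x1 ->
  g 0 = node_pos R y0 -> g 1 = node_pos R y1 ->
  right_of x0 y0 (+) right_of x0 y1 (+) (right_of x1 y0 (+) right_of x1 y1) = false.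
Proof.
move=> fx0 fx1 gy0 gy1.
have cI := @segment_compact R 0 1.
have [e e0 He] := compact_disjoint_dist cI cf cg fg0.
have e2 : 0 < e / 2 by rewrite divr_gt0.
have [d1 d10 H1] := compact_uniformly_continuous cI cf e2.
have [d2 d20 H2] := compact_uniformly_continuous cI cg e2.
have d0 : 0 < Num.min d1 d2 by rewrite lt_min d10.
have [u [N [u0 uN] [uI du]]] := unit_grid_exists d0.
pose F i j := f (u i) - g (u j).
have farF i j : (i <= N)%N -> (j <= N)%N -> far e (F i j).
  by move=> iN jN; apply/far_norm/He; apply: uI.
have nearbyF i j i' j' : (i <= i' <= i.+1)%N -> (i' <= N)%N ->
     (j' <= j.+1)%N -> (j <= j'.+1)%N -> (j <= N)%N -> (j' <= N)%N ->
     nearby e (F i j) (F i' j').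
  move=> /andP[ii i'i] i'N jj j'j jN j'N; apply: nearby_norm.
  have -> : F i j - F i' j' = (f (u i) - f (u i')) - (g (u j) - g (u j')).
    by rewrite /F !opprD !opprK addrACA.
  apply: le_lt_trans (ler_normB _ _) _; rewrite [e]splitr ltrD //.
    apply: H1; [exact/uI/(leq_trans ii) | exact: uI |].
    by have := @du i i' (leqW ii) i'i; rewrite lt_min => /andP[].
  apply: H2; [exact: uI | exact: uI |].
  by have := @du j j' j'j jj; rewrite lt_min => /andP[].
have := crosses_grid farF nearbyF.
have edge_x i (x : node n) : (i = 0 \/ i = N)%N -> f (u i) = node_pos R x ->
  \big[addb/false]_(j < N) crosses (F i j) (F i j.+1) =
  if x is inl _ then false else on_ray (F i 0) (+) on_ray (F i N).
  move=> iE fx; have iN : (i <= N)%N by case: iE => ->.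
  have g01 j : (j <= N)%N -> 0 <= (g (u j)).2 <= 1 by move=> ?; apply/sg/uI.
  case: x fx => k fx.
    apply: crosses_sum_upper => j jN; rewrite /F fx /=.
    by rewrite subr_ge0; case/andP: (g01 j jN).
  apply: (@crosses_sum_lower _ e (F i)) => j jN.
  - exact: farF.
  - by apply: nearbyF; rewrite ?leqnn ?leqnSn ?leqW //= ?leqnSn // ltnW.
  - by rewrite /F fx /= sub0r oppr_le0; case/andP: (g01 j jN).
have edge_y j (y : node n) : (j = 0 \/ j = N)%N -> g (u j) = node_pos R y ->
  \big[addb/false]_(i < N) crosses (F i j) (F i.+1 j) =
  if y is inr _ then false else on_ray (F 0 j) (+) on_ray (F N j).
  move=> jE gy; have jN : (j <= N)%N by case: jE => ->.
  have f01 i : (i <= N)%N -> 0 <= (f (u i)).2 <= 1 by move=> ?; apply/sf/uI.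
  case: y gy => k gy; last first.
    apply: (@crosses_sum_upper _ (F^~ j)) => i iN; rewrite /F gy /=.
    by rewrite subr0; case/andP: (f01 i iN).
  apply: (@crosses_sum_lower _ e (F^~ j)) => i iN.
  - exact: farF.
  - by apply: nearbyF; rewrite ?leqnn ?leqnSn ?leqW //= ?leqnSn // ltnW.
  - by rewrite /F gy /= subr_le0; case/andP: (f01 i iN).
rewrite (@edge_x 0%N x0) ?(@edge_x N x1) ?(@edge_y 0%N y0) ?(@edge_y N y1) ?u0 ?uN //;
  try by [left|right].
rewrite /F u0 uN fx0 fx1 gy0 gy1 /on_ray /upper_half /right_half.
case: x0 fx0 => a0 _; case: x1 fx1 => a1 _;
case: y0 gy0 => b0 _; case: y1 gy1 => b1 _ /=;
rewrite ?subrr ?sub0r ?subr0 ?lexx ?ler01 ?ler0N1 ?ltr0N1 ?subr_gt0 ?ltr_nat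
  ?andbT ?andTb ?addbF ?addFb //=.
all: by case: (b0 < a0)%N; case: (b0 < a1)%N; case: (b1 < a0)%N; case: (b1 < a1)%N.
Qed.

End Linking.

(* For two-element blocks, the sum is even exactly when they do not interleave on the boundary of
   the strip; unlike interleaving, it is additive in [B] and [C]. *)
Definition unlinked n (a : {set {set node n}}) : Prop :=
  forall B C, B \in a -> C \in a -> B != C ->
    ~~ odd (\sum_(x in B) \sum_(y in C) right_of x y)%N.

Lemma node_pos_inj (R : realType) n : injective (@node_pos R n).
Proof.
case=> i [] j [/eqP]; rewrite eqr_nat => /eqP/val_inj ->.
- by [].
- by move=> /eqP; rewrite oner_eq0.
- by move=> /esym/eqP; rewrite oner_eq0.
- by [].
Qed.

Lemma arc_ends (R : realType) n (B : {set node n}) (p q : R * R) : #|B| = 2%N ->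
  [set p; q] = [set node_pos R x | x in [set` B]] ->
  exists x y : node n, [/\ p = node_pos R x, q = node_pos R y, x != y & B = [set x; y]%SET].
Proof.
move=> B2 E.
have [x xB px] : [set node_pos R x | x in [set` B]] p by rewrite -E; left.
have [y yB qy] : [set node_pos R x | x in [set` B]] q by rewrite -E; right.
have BE : B = [set x; y]%SET.
  apply/setP => z; rewrite !inE; apply/idP/idP => [zB|/orP[]/eqP->//].
  have : [set p; q] (node_pos R z) by rewrite E; exists z.
  by rewrite -px -qy; case=> /node_pos_inj ->; rewrite eqxx ?orbT.
exists x, y; split => //.
by move: B2; rewrite BE cards2; case: (x != y).
Qed.

(** The bridge from topology to combinatorics: from here on planarity is used only through
    [unlinked]. *)
Lemma planar_unlinked (R : realType) n (a : {set {set node n}}) :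
  is_pairing a -> planar R a -> unlinked a.
Proof.
move=> /andP[_ /forall_inP a2] [g [garc gdisj]] B C Ba Ca BC.
have [cB _ sB EB] := garc B Ba; have [cC _ sC EC] := garc C Ca.
have [x0 [x1 [Ex0 Ex1 x01 ->]]] := arc_ends (eqP (a2 B Ba)) EB.
have [y0 [y1 [Ey0 Ey1 y01 ->]]] := arc_ends (eqP (a2 C Ca)) EC.
rewrite big_setU1 ?inE //= !big_set1 !big_setU1 ?inE //= !big_set1 !oddD !oddb.
by rewrite (disjoint_arcs_unlinked cB cC sB sC (gdisj B C Ba Ca BC) Ex0 Ex1 Ey0 Ey1).
Qed.

End DisjointArcs.

(** * Paths and cycles formed by two matchings *)

Section AlternatingWalk.
Variables (T : eqType) (f g : T -> T) (x : T).
Hypotheses (fK : involutive f) (gK : involutive g).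
Hypotheses (fg_neq : forall u, f u = u -> g u <> u) (gx : g x = x).

Let fixed u := (f u == u) || (g u == u).

Fixpoint alternating_walk k : T :=
  if k is k'.+1 then (if odd k' then g else f) (alternating_walk k') else x.

(** A point fixed by [f] or [g] is an end of the path, where the walk turns back; the condition
    keeps to the stretch up to the first such point after [x]. *)
Definition walk_reaches z :=
  exists2 i, z = alternating_walk i &
    forall j, (0 < j < i)%N -> ~~ fixed (alternating_walk j).

Lemma walk_reaches_step z : walk_reaches z -> walk_reaches (f z) /\ walk_reaches (g z).
Proof.
case=> -[|k] -> hk.
  by rewrite gx; split; [exists 1%N | exists 0%N] => // -[|[]].
set z' := alternating_walk k.+1.
(* [h] is the map that led to [z'], so it leads back; [h'] is the next map of the walk. *)
pose h := if odd k then g else f; pose h' := if odd k then f else g.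
suff [] : walk_reaches (h z') /\ walk_reaches (h' z').
  by rewrite /h /h'; case: (odd k).
have hz : h z' = alternating_walk k by rewrite /h /z' /=; case: (odd k).
have h'z : h' z' = alternating_walk k.+2 by rewrite /h' /z' /=; case: (odd k).
have rk : walk_reaches (alternating_walk k).
  by exists k => // j /andP[j0 jk]; apply: hk; rewrite j0 ltnW.
split; first by rewrite hz.
have [fz|nfz] := boolP (fixed z'); last first.
  exists k.+2; rewrite ?h'z // => j /andP[j0]; rewrite ltnS leq_eqVlt.
  by case/orP=> [/eqP->//|jk]; apply: hk; rewrite j0.
(* If [h] fixed [z'], the walk would have been at [z'] one step before: either an earlier end,
   excluded by [hk], or [x] itself fixed by both maps. So [h'] fixes it. *)
have /orP[/eqP hzz|/eqP->] : (h z' == z') || (h' z' == z').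
- by move: fz; rewrite /fixed /h /h'; case: (odd k); rewrite // orbC.
- case: (posnP k) => [k0|kp].
    move: hzz; rewrite hz /z' k0 /= => /esym fx.
    by have := fg_neq fx; rewrite gx.
  by have := hk k; rewrite kp ltnSn -hz hzz fz => /(_ isT).
- by exists k.+1.
Qed.

(** Both are the first fixed point of the walk after [x], so they have the same index. *)
Lemma walk_reaches_fixed y z : walk_reaches y -> walk_reaches z ->
  fixed y -> fixed z -> y != x -> z != x -> y = z.
Proof.
move=> [i -> hi] [j -> hj] fy fz.
case: i hi fy => [|i] hi fy; first by rewrite eqxx.
case: j hj fz => [|j] hj fz _; first by rewrite eqxx.
case: (ltngtP i j) => [ij|ji|-> //].
  by have := hj i.+1 ij; rewrite fy.
by have := hi j.+1 ji; rewrite fz.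
Qed.

End AlternatingWalk.

(* A component of the union of two partial matchings is a path or a cycle, so at most two of
   its points are unmatched on one side. *)
Lemma connect_involutions_fixed (T : finType) (f g : T -> T) (e : rel T) :
  involutive f -> involutive g -> (forall u, f u = u -> g u <> u) ->
  (forall u v, e u v -> [|| v == u, v == f u | v == g u]) ->
  forall x y z, (f x == x) || (g x == x) -> (f y == y) || (g y == y) ->
  (f z == z) || (g z == z) -> connect e x y -> connect e x z ->
  y != x -> z != x -> y = z.
Proof.
move=> fK gK fg_neq efg x y z.
wlog /eqP gx : f g fK gK fg_neq efg / g x == x.
  move=> wl /[dup] /orP[fx|gx] fgx; last exact: (wl f g).
  rewrite ![(f _ == _) || _]orbC; apply: (wl g f) => //; last by rewrite fx orbT.
    by move=> u gu fu; apply: (fg_neq u).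
  by move=> u v /efg /or3P[]->; rewrite ?orbT.
have reach u : connect e x u -> walk_reaches f g x u.
  case/connectP=> p; elim/last_ind: p u => [|p v IH] u /=.
    by move=> _ ->; exists 0%N => // -[].
  rewrite rcons_path last_rcons => /andP[ep ev] ->.
  have r := IH _ ep erefl; have [rf rg] := walk_reaches_step fK gK fg_neq gx r.
  by case/or3P: (efg _ _ ev) => /eqP ->.
move=> _ fy fz /reach ry /reach rz; exact: walk_reaches_fixed ry rz fy fz.
Qed.

(** * Unions of blocks of a partition *)

Section Blocks.
Variable T : finType.
Implicit Types (a : {set {set T}}) (S : {set T}).

(** For a partition [a] this says that [S] is a union of blocks. *)
Definition saturated a S : Prop :=
  forall B x, B \in a -> x \in B -> x \in S -> B \subset S.

Lemma sum_saturated a S (h : T -> nat) : finset.partition a [set: T] -> saturated a S ->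
  \sum_(x in S) h x = \sum_(B in a | B \subset S) \sum_(x in B) h x.
Proof.
case/and3P=> /eqP cov tri _ sat.
have SE : finset.cover [set B in a | B \subset S]%SET = S.
  apply/setP => x; apply/bigcupP/idP => [[B]|xS].
    by rewrite inE => /andP[_ /fintype.subsetP]; apply.
  have : x \in finset.cover a by rewrite cov inE.
  by case/bigcupP=> B Ba xB; exists B => //; rewrite inE Ba (sat B x).
rewrite -{1}SE finset.big_trivIset; last first.
  by apply: trivIsetS tri; apply/fintype.subsetP => B; rewrite inE => /andP[].
by apply: eq_bigl => B; rewrite inE.
Qed.

Definition same_block a : rel T := fun x y => [exists B in a, (x \in B) && (y \in B)].

Lemma same_blockP a x y :
  reflect (exists2 B, B \in a & (x \in B) /\ (y \in B)) (same_block a x y).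
Proof.
apply: (iffP exists_inP) => -[B Ba]; first by case/andP; exists B.
by case=> xB yB; exists B => //; rewrite xB.
Qed.

Lemma same_block_sym a : symmetric (same_block a).
Proof. by move=> x y; apply/same_blockP/same_blockP => -[B Ba []]; exists B. Qed.

Lemma partition_block_eq a B C x : finset.partition a [set: T] ->
  B \in a -> C \in a -> x \in B -> x \in C -> B = C.
Proof.
case/and3P=> _ tri _ Ba Ca xB xC.
by rewrite -(def_pblock tri Ba xB) (def_pblock tri Ca xC).
Qed.

Lemma same_block_refl a : finset.partition a [set: T] -> reflexive (same_block a).
Proof.
case/and3P=> /eqP cov _ _ x; have : x \in finset.cover a by rewrite cov inE.
by case/bigcupP=> B Ba xB; apply/same_blockP; exists B.
Qed.

(** A partition is recovered from its relation, so pairings can be compared through [same_block]. *)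
Lemma partition_same_block a : finset.partition a [set: T] ->
  a = [set [set y | same_block a x y] | x : T]%SET.
Proof.
move=> pa; have blockE B x : B \in a -> x \in B -> B = [set y | same_block a x y]%SET.
  move=> Ba xB; apply/setP => y; rewrite inE; apply/idP/same_blockP => [yB|].
    by exists B.
  by case=> C Ca [xC]; rewrite (partition_block_eq pa Ba Ca xB xC).
apply/setP => B; apply/idP/imsetP => [Ba|[x _ ->]].
  case/and3P: (pa) => _ _ n0.
  have /set0Pn[x xB] : B != finset.set0 by apply: contraNneq n0 => <-.
  by exists x => //; apply: blockE.
have /same_blockP[C Ca [xC _]] := same_block_refl pa x.
by rewrite -(blockE C x).
Qed.

End Blocks.

(** * Partners in a pairing *)

Section Pairing.
Variables (n : nat) (a : {set {set node n}}).
Hypothesis pa : is_pairing a.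

Lemma pairing_partition : finset.partition a [set: node n].
Proof. by case/andP: pa. Qed.

Lemma pairing_block_uniq x y z :
  same_block a x y -> same_block a x z -> y != x -> z != x -> y = z.
Proof.
move=> /same_blockP[B Ba [xB yB]] /same_blockP[C Ca [xC zC]] yx zx.
rewrite -(partition_block_eq pairing_partition Ba Ca xB xC) in zC.
have /eqP B2 : #|B| == 2%N by case/andP: pa => _ /forall_inP; apply.
have := cardsD1 x B; rewrite B2 xB => -[] /esym/eqP/cards1P[w Bw].
have : y \in B :\ x by rewrite !inE yx.
have : z \in B :\ x by rewrite !inE zx.
by rewrite Bw !inE => /eqP-> /eqP.
Qed.

Lemma pairing_partner : exists f : node n -> node n,
  [/\ involutive f, forall x, f x != x &
      forall x y, same_block a x y = (y == x) || (y == f x)].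
Proof.
have partner_ex x : exists y, (y != x) && same_block a x y.
  have /same_blockP[B Ba [xB _]] := same_block_refl pairing_partition x.
  have /eqP B2 : #|B| == 2%N by case/andP: pa => _ /forall_inP; apply.
  have : (0 < #|B :\ x|)%N by have := cardsD1 x B; rewrite B2 xB; case: #|_|.
  case/card_gt0P=> y; rewrite !inE => /andP[yx yB]; exists y; rewrite yx.
  by apply/same_blockP; exists B.
pose f x := xchoose (partner_ex x).
have fx x : f x != x by case/andP: (xchooseP (partner_ex x)).
have sf x : same_block a x (f x) by case/andP: (xchooseP (partner_ex x)).
have fK : involutive f.
  move=> x; apply: (@pairing_block_uniq (f x)) => //.
  - by rewrite same_block_sym.
  - by rewrite eq_sym.
exists f; split=> // x y; have [->|yx] /= := eqVneq y x.
  exact: same_block_refl pairing_partition x.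
apply/idP/eqP => [xy|->//]; exact: (pairing_block_uniq xy).
Qed.

Lemma unlinked_same_block x y x' y' : unlinked a -> same_block a x y ->
  same_block a x' y' -> x != y -> x' != y' -> ~~ same_block a x x' ->
  right_of x x' (+) right_of x y' (+) (right_of y x' (+) right_of y y') = false.
Proof.
move=> ua /same_blockP[B Ba [xB yB]] /same_blockP[C Ca [xC yC]] xy xy' nxx'.
have pairE D (u v : node n) : D \in a -> u \in D -> v \in D -> u != v -> D = [set u; v]%SET.
  move=> Da uD vD uv; apply/eqP; rewrite eq_sym eqEcard; apply/andP; split.
    by apply/fintype.subsetP => w; rewrite !inE => /orP[]/eqP->.
  by rewrite cards2 uv; case/andP: pa => _ /forall_inP/(_ D Da)/eqP->.
have BC : B != C.
  by apply: contraNneq nxx' => BC; apply/same_blockP; exists B; rewrite // BC in xB *.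
have := ua B C Ba Ca BC; rewrite (pairE B x y) // (pairE C x' y') //.
rewrite big_setU1 ?inE //= !big_set1 !big_setU1 ?inE //= !big_set1 !oddD !oddb.
by move/negbTE.
Qed.

End Pairing.

(** * The glued diagram *)

Section Gluing.
Variables (n : nat) (a b : {set {set node n}}).
Hypotheses (pa : is_pairing a) (pb : is_pairing b).

Lemma upper_inj : injective (@upper n).
Proof. by move=> [i|i] [j|j] //= [->]. Qed.

Lemma lower_inj : injective (@lower n).
Proof. by move=> [i|i] [j|j] //= [->]. Qed.

Lemma joinedP u v : reflect
  ((exists x y, [/\ u = upper x, v = upper y & same_block a x y]) \/
   (exists x y, [/\ u = lower x, v = lower y & same_block b x y]))
  (joined a b u v).
Proof.
apply: (iffP exists_inP) => [[E]|].
  rewrite inE => /orP[]/imsetP[B Bab ->] /andP[/imsetP[x xB ->] /imsetP[y yB ->]].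
    by left; exists x, y; split => //; apply/same_blockP; exists B.
  by right; exists x, y; split => //; apply/same_blockP; exists B.
case=> -[x [y [-> -> /same_blockP[B Bab [xB yB]]]]].
  by exists (@upper n @: B)%SET; rewrite ?inE ?imset_f.
by exists (@lower n @: B)%SET; rewrite ?inE ?imset_f ?orbT.
Qed.

Lemma joined_connect_sym : connect_sym (joined a b).
Proof.
apply: sym_connect_sym => u v; apply/joinedP/joinedP.
  by case=> -[x [y [-> ->]]]; rewrite same_block_sym; [left|right]; exists y, x.
by case=> -[x [y [-> ->]]]; rewrite same_block_sym; [left|right]; exists y, x.
Qed.

(** Each pairing acts by exchanging partners, extended by the identity on the outer row that it does
    not touch: [f], from [a], fixes exactly the bottom row and [g], from [b], the top row. The outer
    nodes are therefore the ends of the paths. *)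
Lemma joined_involutions : exists f g : glued_node n -> glued_node n,
  [/\ involutive f, involutive g,
      forall u, (f u == u) = if u is inl (inr _) then true else false,
      forall u, (g u == u) = if u is inl (inl _) then true else false &
      forall u v, joined a b u v -> [|| v == u, v == f u | v == g u]].
Proof.
have [f [fK f_neq fP]] := pairing_partner pa.
have [g [gK g_neq gP]] := pairing_partner pb.
pose f' u := match u with
  | inl (inl i) => upper (f (inl i))
  | inl (inr i) => u
  | inr i => upper (f (inr i)) end.
pose g' u := match u with
  | inl (inl i) => u
  | inl (inr i) => lower (g (inr i))
  | inr i => lower (g (inl i)) end.
have f'E x : f' (upper x) = upper (f x) by case: x.
have g'E x : g' (lower x) = lower (g x) by case: x.
exists f', g'; split.
- by case=> [[i|i]|i] //=; rewrite f'E fK.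
- by case=> [[i|i]|i] //=; rewrite g'E gK.
- case=> [[i|i]|i] /=; rewrite ?eqxx //.
    by rewrite (inj_eq upper_inj _ (inl i)) (negbTE (f_neq _)).
  by rewrite (inj_eq upper_inj _ (inr i)) (negbTE (f_neq _)).
- case=> [[i|i]|i] /=; rewrite ?eqxx //.
    by rewrite (inj_eq lower_inj _ (inr i)) (negbTE (g_neq _)).
  by rewrite (inj_eq lower_inj _ (inl i)) (negbTE (g_neq _)).
- move=> u v /joinedP[]; move=> [x [y [-> ->]]].
    by rewrite fP f'E => /orP[]/eqP->; rewrite eqxx ?orbT.
  by rewrite gP g'E => /orP[]/eqP->; rewrite eqxx ?orbT.
Qed.

Lemma connect_outer_nodes_uniq (x y z : node n) :
  connect (joined a b) (inl x) (inl y) -> connect (joined a b) (inl x) (inl z) ->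
  y != x -> z != x -> y = z.
Proof.
have [f [g [fK gK fE gE fgE]]] := joined_involutions.
have fg u : f u = u -> g u <> u.
  by move=> /eqP fu /eqP gu; move: fu gu; rewrite fE gE; case: u => [[]|].
have fixed (w : node n) : (f (inl w) == inl w) || (g (inl w) == inl w).
  by rewrite fE gE; case: w.
move=> xy xz yx zx; apply: (@inl_inj _ 'I_n).
exact: (connect_involutions_fixed fK gK fg fgE (fixed x) (fixed y) (fixed z)).
Qed.

Lemma strandsP (S : {set glued_node n}) : S \in strands a b ->
  exists u, S = [set v | connect (joined a b) u v]%SET.
Proof. by case/imsetP=> u _ ->; exists u. Qed.

Lemma strands_eq S S' u : S \in strands a b -> S' \in strands a b ->
  u \in S -> u \in S' -> S = S'.
Proof.
move=> /strandsP[v ->] /strandsP[w ->]; rewrite !inE => vu wu.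
apply/setP => z; rewrite !inE; apply: (same_connect joined_connect_sym).
by apply: connect_trans vu _; rewrite joined_connect_sym.
Qed.

Lemma same_block_glued x y :
  same_block (glued_pairs a b) x y = connect (joined a b) (inl x) (inl y).
Proof.
apply/same_blockP/idP => [[B]|xy].
  rewrite !inE => /andP[_ /imsetP[S /strandsP[u ->] ->]]; rewrite !inE => -[ux uy].
  by apply: connect_trans uy; rewrite joined_connect_sym.
exists (outer_nodes [set v | connect (joined a b) (inl x) v]%SET); last first.
  by rewrite !inE connect0 xy.
rewrite !inE; apply/andP; split.
  by apply/set0Pn; exists x; rewrite !inE connect0.
by apply: imset_f; apply: imset_f.
Qed.

Lemma saturated_upper S : S \in strands a b -> saturated a (@upper n @^-1: S).
Proof.
case/strandsP=> u -> B x Ba xB; rewrite !inE => ux; apply/fintype.subsetP => y yB.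
rewrite !inE; apply: connect_trans ux _; apply: connect1; apply/joinedP; left.
by exists x, y; split => //; apply/same_blockP; exists B.
Qed.

Lemma saturated_lower S : S \in strands a b -> saturated b (@lower n @^-1: S).
Proof.
case/strandsP=> u -> B x Ba xB; rewrite !inE => ux; apply/fintype.subsetP => y yB.
rewrite !inE; apply: connect_trans ux _; apply: connect1; apply/joinedP; right.
by exists x, y; split => //; apply/same_blockP; exists B.
Qed.

Lemma sum_upper (S : {set glued_node n}) (h : node n -> nat) :
  \sum_(x in @upper n @^-1: S) h x =
  (\sum_(i | inl (inl i) \in S) h (inl i) + \sum_(i | inr i \in S) h (inr i))%N.
Proof. by rewrite big_sumType; congr (_ + _)%N; apply: eq_bigl => i; rewrite !inE. Qed.

Lemma sum_lower (S : {set glued_node n}) (h : node n -> nat) :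
  \sum_(x in @lower n @^-1: S) h x =
  (\sum_(i | inr i \in S) h (inl i) + \sum_(i | inl (inr i) \in S) h (inr i))%N.
Proof. by rewrite big_sumType; congr (_ + _)%N; apply: eq_bigl => i; rewrite !inE. Qed.

Lemma sum_outer (S : {set glued_node n}) (h : node n -> nat) :
  \sum_(x in outer_nodes S) h x =
  (\sum_(i | inl (inl i) \in S) h (inl i) + \sum_(i | inl (inr i) \in S) h (inr i))%N.
Proof. by rewrite big_sumType; congr (_ + _)%N; apply: eq_bigl => i; rewrite !inE. Qed.

Lemma not_odd_sum (I : finType) (P : pred I) (F : I -> nat) :
  (forall i, P i -> ~~ odd (F i)) -> ~~ odd (\sum_(i | P i) F i).
Proof.
by move=> H; elim/big_ind: _ => // x y; rewrite oddD => /negbTE-> /negbTE->.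
Qed.

Lemma saturated_even (c : {set {set node n}}) S : is_pairing c -> saturated c S -> ~~ odd #|S|.
Proof.
move=> pc satS; rewrite -sum1_card (sum_saturated _ (pairing_partition pc) satS).
apply: not_odd_sum => B /andP[Bc _]; rewrite sum1_card.
by case/andP: pc => _ /forall_inP/(_ B Bc)/eqP->.
Qed.

(** The upper part of a strand has its top and middle nodes, the lower part its middle and bottom
    ones; both counts are even, and the middle cancels in their sum. *)
Lemma outer_nodes_even S : S \in strands a b -> ~~ odd #|outer_nodes S|.
Proof.
move=> Sab; have := saturated_even pa (saturated_upper Sab).
have := saturated_even pb (saturated_lower Sab).
rewrite -!sum1_card sum_upper sum_lower sum_outer !oddD.
by do 3!case: (odd _).
Qed.

Lemma glued_pairing : is_pairing (glued_pairs a b).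
Proof.
apply/andP; split.
  apply/and3P; split; last by rewrite !inE eqxx.
    apply/eqP/setP => x; rewrite !inE.
    have [B Bg [xB _]] : exists2 B, B \in glued_pairs a b & x \in B /\ x \in B.
      by apply/same_blockP; rewrite same_block_glued connect0.
    by apply/bigcupP; exists B.
  apply/finset.trivIsetP => B C; rewrite !inE => /andP[_ /imsetP[S Sab ->]].
  move=> /andP[_ /imsetP[S' S'ab ->]]; apply: contraR => /pred0Pn[x /=].
  by rewrite !inE => /andP[xS xS']; rewrite (strands_eq Sab S'ab xS xS').
apply/forall_inP => B; rewrite !inE => /andP[B0 /imsetP[S Sab BE]].
(* Nonempty, even and at most two, since a path has two ends: hence exactly two. *)
have := outer_nodes_even Sab; rewrite -BE.
have : (#|B| <= 2)%N.
  rewrite leqNgt; apply/card_gt2P => -[x [y [z [[xB yB zB] [xy yz zx]]]]].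
  move: xB yB zB; rewrite BE !inE; have [u ->] := strandsP Sab; rewrite !inE => xu yu zu.
  have xu' : connect (joined a b) (inl x) u by rewrite joined_connect_sym.
  have := connect_outer_nodes_uniq (connect_trans xu' yu) (connect_trans xu' zu).
  by rewrite eq_sym xy zx => /(_ isT isT) yzE; rewrite yzE eqxx in yz.
by rewrite -card_gt0 in B0; case: #|B| B0 => [|[|[]]].
Qed.

Lemma glued_unlinked : unlinked a -> unlinked b -> unlinked (glued_pairs a b).
Proof.
(* The parity is additive over the blocks in [X] and in [Y]; a block of one is never a block of the
   other, as [X] and [Y] are disjoint. *)
have even_link (c : {set {set node n}}) X Y : is_pairing c -> unlinked c ->
    saturated c X -> saturated c Y -> [disjoint X & Y] ->
    ~~ odd (\sum_(x in X) \sum_(y in Y) right_of x y).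
  move=> pc uc satX satY XY; have partc := pairing_partition pc.
  rewrite (sum_saturated _ partc satX); apply: not_odd_sum => B /andP[Bc BX].
  under eq_bigr do rewrite (sum_saturated _ partc satY).
  rewrite exchange_big /=; apply: not_odd_sum => C /andP[Cc CY]; apply: uc => //.
  apply/negP => /eqP BC; have /set0Pn[x xB] : B != finset.set0.
    by case/and3P: partc => _ _; apply: contraNneq => <-.
  have /negP[] := disjointFr XY (fintype.subsetP BX x xB).
  by apply: (fintype.subsetP CY); rewrite -BC.
move=> ua ub B C; rewrite !inE => /andP[_ /imsetP[S Sab ->]] /andP[_ /imsetP[S' S'ab ->]] SS'.
have dSS' : [disjoint S & S'].
  apply/pred0P => u /=; apply/negP => /andP[uS uS'].
  by move: SS'; rewrite (strands_eq Sab S'ab uS uS') eqxx.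
have dis (h : node n -> glued_node n) : [disjoint h @^-1: S & h @^-1: S'].
  apply/pred0P => u /=; rewrite !inE; apply/negP => /andP[uS uS'].
  by move: uS'; rewrite (disjointFr dSS' uS).
have := even_link a _ _ pa ua (saturated_upper Sab) (saturated_upper S'ab) (dis _).
have := even_link b _ _ pb ub (saturated_lower Sab) (saturated_lower S'ab) (dis _).
(* [right_of] vanishes across rows, so the upper sum is top plus middle and the lower one middle
   plus bottom; the middle terms coincide and cancel mod 2. *)
rewrite sum_upper sum_lower sum_outer.
under eq_bigr do rewrite sum_lower /= big1_eq addn0.
under [X in odd (_ + X)]eq_bigr do rewrite sum_lower /= big1_eq add0n.
move=> lowE.
under eq_bigr do rewrite sum_upper /= big1_eq addn0.
under [X in odd (_ + X)]eq_bigr do rewrite sum_upper /= big1_eq add0n.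
move: lowE => /[swap].
under [X in _ -> _ -> ~~ odd (X + _)]eq_bigr do rewrite sum_outer /= big1_eq addn0.
under [X in _ -> _ -> ~~ odd (_ + X)]eq_bigr do rewrite sum_outer /= big1_eq add0n.
by rewrite !oddD; do 3!case: (odd _).
Qed.

End Gluing.

(** * Stabilization of powers *)

(** The diagram [a] with its bottom row closed off by [T]. With the top-top pairs of [b] as [T], it
    keeps just the part of [b] from which a strand can return to [a]. *)
Definition capped n (a : {set {set node n}}) (T : rel 'I_n) : rel (node n) :=
  fun x y => same_block a x y ||
    match x, y with inr i, inr j => T i j | _, _ => false end.

Definition top_block n (a : {set {set node n}}) : rel 'I_n :=
  fun i j => same_block a (inl i) (inl j).

Lemma connect_capped_mono n (a : {set {set node n}}) (T T' : rel 'I_n) :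
  subrel T T' -> subrel (connect (capped a T)) (connect (capped a T')).
Proof.
move=> TT'; apply: connect_sub => x y xy; apply: connect1.
move: xy; rewrite /capped => /orP[->//|]; case: x => // i; case: y => // j.
by move/TT' => ->; rewrite orbT.
Qed.

Lemma connect_capped_glued n (a b : {set {set node n}}) x y :
  connect (capped a (top_block b)) x y -> connect (joined a b) (upper x) (upper y).
Proof.
case/connectP=> p; elim/last_ind: p y => [|p v IH] y /=; first by move=> _ ->.
rewrite rcons_path last_rcons => /andP[ep ev] ->.
apply: connect_trans (IH _ ep erefl) _; apply: connect1; apply/joinedP.
move: ev; set u := last x p; case/orP=> [uv|]; first by left; exists u, v.
case: u => // i; case: v => // j ij.
by right; exists (inl i), (inl j).
Qed.

(* A strand joining two top nodes never uses a through strand of [b], as it could not come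
   back: so the top of the product is determined by [a] and the top of [b]. *)
Lemma top_block_glued n (a b : {set {set node n}}) : is_pairing a -> is_pairing b ->
  forall i j, top_block (glued_pairs a b) i j =
    connect (capped a (top_block b)) (inl i) (inl j).
Proof.
move=> pa pb i j; rewrite /top_block same_block_glued; apply/idP/idP; last first.
  exact: connect_capped_glued.
move=> ij; have [<-|ij_neq] := eqVneq i j; first exact: connect0.
(* If the capped diagram leads from [i] to a through block of [b], the strand of [i] has three outer
   nodes: [i], [j] and the bottom node [l]. *)
have [/existsP[k /existsP[l /andP[ik kl]]]|no_through] := boolP
    [exists k, exists l, connect (capped a (top_block b)) (inl i) (inr k)
       && same_block b (inl k) (inr l)].
  have il : connect (joined a b) (inl (inl i)) (inl (inr l)).
    apply: connect_trans (connect_capped_glued ik) _; apply: connect1.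
    by apply/joinedP; right; exists (inl k), (inr l).
  have := connect_outer_nodes_uniq pa pb ij il.
  by rewrite (inj_eq (@inl_inj _ _)) eq_sym ij_neq => /(_ isT isT).
(* Otherwise the strand never leaves the image of [upper], and its path lifts to the capped
   diagram. *)
suff H v : connect (joined a b) (inl (inl i)) v ->
    exists2 y, v = upper y & connect (capped a (top_block b)) (inl i) y.
  by have [[j'|//] [->]] := H _ ij.
case/connectP=> p; elim/last_ind: p v => [|p v IH] v' /=.
  by move=> _ ->; exists (inl i); rewrite ?connect0.
rewrite rcons_path last_rcons => /andP[ep ev] ->.
have [x ux ix] := IH _ ep erefl; move: ev; rewrite ux.
case/joinedP=> -[x' [y [xx' -> xy]]].
  move: xx' xy => /(@upper_inj n) <- xy; exists y => //.
  by apply: connect_trans ix (connect1 _); rewrite /capped xy.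
case: x ix {ux} xx' => k ik; case: x' xy => // k' k'y [kk'].
rewrite -{k'}kk' in k'y; case: y k'y => l kl; last first.
  by case/negP: no_through; apply/existsP; exists k; apply/existsP; exists l; rewrite ik.
exists (inr l) => //; apply: connect_trans ik (connect1 _).
by rewrite /capped /top_block kl orbT.
Qed.

(** * Through strands are determined by the other pairs *)

Definition same_side n (x y : node n) : bool :=
  match x, y with inl _, inl _ | inr _, inr _ => true | _, _ => false end.

Section Through.
Variable n : nat.
Implicit Types c : {set {set node n}}.

(** If [j < j'], the partner of [j] in [c'] is a top node [i2], as [j] is a through node of [c] and
    same-side pairs agree. The parity makes the through strands of [c'] preserve the order, so
    [i2 < i]. Then [i2] is also through in [c], and by [IH] it goes to [j], the partner of [i]: a
    contradiction. *)
Lemma through_block_leq c c' (i j j' : 'I_n) : is_pairing c -> is_pairing c' -> unlinked c' ->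
  (forall x y, same_side x y -> same_block c x y = same_block c' x y) ->
  (forall (i2 : 'I_n) k k', (i2 < i)%N -> same_block c (inl i2) (inr k) ->
     same_block c' (inl i2) (inr k') -> k = k') ->
  same_block c (inl i) (inr j) -> same_block c' (inl i) (inr j') -> (j' <= j)%N.
Proof.
move=> pc pc' uc' cc' IH ij ij'; rewrite leqNgt; apply/negP => jj'.
have [f [_ f_neq fP]] := pairing_partner pc.
have [f' [_ f'_neq f'P]] := pairing_partner pc'.
have j_j' : j != j' by rewrite neq_ltn jj'.
have := f'P (inr j) (f' (inr j)); rewrite eqxx orbT.
case E : (f' (inr j)) => [i2|k] jk; last first.
  have jk_neq := f'_neq (inr j); rewrite E in jk_neq.
  rewrite -cc' // in jk; rewrite same_block_sym in ij.
  by have := pairing_block_uniq pc ij jk isT jk_neq.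
rewrite same_block_sym in jk.
have i2i : i2 != i.
  apply/eqP => i2i; rewrite i2i in jk.
  have := pairing_block_uniq pc' jk ij' isT isT.
  by move=> [] jE; rewrite jE eqxx in j_j'.
have nii2 : ~~ same_block c' (inl i) (inl i2).
  apply/negP => ii2; have := pairing_block_uniq pc' ij' ii2 isT.
  by rewrite (inj_eq (@inl_inj _ _)) => /(_ i2i).
have := unlinked_same_block pc' uc' ij' jk isT isT nii2.
rewrite /= jj' addbT addbF => /negbFE i2_lt.
have := fP (inl i2) (f (inl i2)); rewrite eqxx orbT.
case E2 : (f (inl i2)) => [i3|k] i2k.
  have i3_neq := f_neq (inl i2); rewrite E2 in i3_neq.
  rewrite cc' // in i2k.
  by have := pairing_block_uniq pc' jk i2k isT i3_neq.
have kj := IH _ _ _ i2_lt i2k jk; rewrite kj same_block_sym in i2k.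
rewrite same_block_sym in ij.
have := pairing_block_uniq pc ij i2k isT isT => -[] iE.
by rewrite iE eqxx in i2i.
Qed.

Lemma through_block_eq c c' : is_pairing c -> is_pairing c' -> unlinked c -> unlinked c' ->
  (forall x y, same_side x y -> same_block c x y = same_block c' x y) ->
  forall i j j', same_block c (inl i) (inr j) -> same_block c' (inl i) (inr j') -> j = j'.
Proof.
move=> pc pc' uc uc' cc' [i i_lt].
elim/ltn_ind: i i_lt => i IH i_lt j j' ij ij'; apply/val_inj/eqP.
rewrite /= eqn_leq; apply/andP; split.
  apply: (through_block_leq pc' pc uc _ _ ij' ij) => [x y /cc' ->//|[i2 i2n] k k' h hk hk'].
  by apply/esym/(IH i2 h i2n).
by apply: (through_block_leq pc pc' uc' cc' _ ij ij') => -[i2 i2n] k k' h; apply: IH.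
Qed.

Lemma same_side_pairing_eq c c' : is_pairing c -> is_pairing c' -> unlinked c -> unlinked c' ->
  (forall x y, same_side x y -> same_block c x y = same_block c' x y) -> c = c'.
Proof.
have through (d d' : {set {set node n}}) i j : is_pairing d -> is_pairing d' ->
    unlinked d -> unlinked d' ->
    (forall x y, same_side x y -> same_block d x y = same_block d' x y) ->
    same_block d (inl i) (inr j) -> same_block d' (inl i) (inr j).
  move=> pd pd' ud ud' dd' ij.
  have [f [_ f_neq fP]] := pairing_partner pd'.
  have := fP (inl i) (f (inl i)); rewrite eqxx orbT.
  case E : (f (inl i)) => [k|k] ik.
    have k_neq := f_neq (inl i); rewrite E in k_neq; rewrite -dd' // in ik.
    by have := pairing_block_uniq pd ij ik isT k_neq.
  by rewrite (through_block_eq pd pd' ud ud' dd' ij ik).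
move=> pc pc' uc uc' cc'.
have cc'E i j : same_block c (inl i) (inr j) = same_block c' (inl i) (inr j).
  apply/idP/idP; apply: through => // x y /cc' ->//.
rewrite (partition_same_block (pairing_partition pc)).
rewrite (partition_same_block (pairing_partition pc')).
apply: eq_imset => x; apply/setP => y; rewrite !inE.
case: x y => i [] j; try exact: cc'.
  exact: cc'E.
by rewrite same_block_sym cc'E same_block_sym.
Qed.

End Through.

Lemma nondecreasing_sets_stabilize (T : finType) (W : nat -> {set T}) :
  (forall m, W m \subset W m.+1) -> exists m, W m = W m.+1.
Proof.
move=> W_mono; have [[m _ /eqP ?]|no_eq] := pselect (exists2 m, true & W m == W m.+1).
  by exists m.
have W_card m : (m <= #|W m|)%N.
  elim: m => // m IH; apply: leq_ltn_trans IH _; apply: proper_card.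
  rewrite finset.properEneq W_mono andbT; apply/negP => Wm; apply: no_eq; by exists m.
by have := leq_trans (W_card #|T|.+1) (max_card _); rewrite ltnn.
Qed.

(** * Powers of a pairing *)

Section Powers.
Variables (n : nat) (a : {set {set node n}}).
Hypotheses (pa : is_pairing a) (ua : unlinked a).

Let c m := iter m (glued_pairs a) a.

Lemma iter_glued_pairing m : is_pairing (c m).
Proof. by elim: m => //= m IH; apply: glued_pairing. Qed.

Lemma iter_glued_unlinked m : unlinked (c m).
Proof. by elim: m => //= m IH; apply: glued_unlinked => //; apply: iter_glued_pairing. Qed.

(** The top of [c m.+1] is a monotone function of the top of [c m], so the first inclusion
    propagates. *)
Lemma top_block_iter_glued m : subrel (top_block (c m)) (top_block (c m.+1)).
Proof.
have topE k i j : top_block (c k.+1) i j =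
    connect (capped a (top_block (c k))) (inl i) (inl j).
  exact: top_block_glued pa (iter_glued_pairing k) i j.
elim: m => [|m IH] i j.
  by rewrite (topE 0%N) => ij; apply: connect1; apply/orP; left.
by rewrite (topE m) (topE m.+1); apply: connect_capped_mono.
Qed.

Lemma iter_glued_same_side m x y : same_side x y ->
  same_block (c m) x y -> same_block (c m.+1) x y.
Proof.
case: x y => i [] j // _; first exact: top_block_iter_glued.
(* Stacking [a] on top leaves the bottom pairs of the lower factor [c m] in place. *)
move=> ij; rewrite /= same_block_glued; apply: connect1; apply/joinedP; right.
by exists (inr i), (inr j).
Qed.

Lemma iter_glued_stabilizes : exists m, c m.+1 = c m.
Proof.
(* These sets increase, hence stabilize; the through strands then agree as well. *)
pose W m := [set z : node n * node n | same_side z.1 z.2 && same_block (c m) z.1 z.2]%SET.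
have [m Wm] : exists m, W m = W m.+1.
  apply: nondecreasing_sets_stabilize => m; apply/fintype.subsetP => -[x y].
  by rewrite !inE /= => /andP[xy]; rewrite xy; apply: iter_glued_same_side.
exists m; apply/esym/same_side_pairing_eq; try exact: iter_glued_pairing;
  try exact: iter_glued_unlinked.
by move=> x y xy; move/setP: Wm => /(_ (x, y)); rewrite !inE /= xy.
Qed.

End Powers.

(** By computation: [P ^+ 1] unfolds to [P], and [P ^+ m.+2] to [P * P ^+ m.+1]. *)
Lemma pairs_exp n (P : expr n) m :
  pairs (P ^+ m.+1)%g = iter m (glued_pairs (pairs P)) (pairs P).
Proof. by elim: m => //= m <-. Qed.

Lemma iter_inj_before_fixed (T : Type) (f : T -> T) x N :
  (forall m, (m < N)%N -> iter m.+1 f x <> iter m f x) -> iter N.+1 f x = iter N f x ->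
  forall i j, (i <= N)%N -> (j <= N)%N -> iter i f x = iter j f x -> i = j.
Proof.
move=> minN fixN.
suff lt_neq i j : (i < j)%N -> (j <= N)%N -> iter i f x <> iter j f x.
  move=> i j iN jN ij; case: (ltngtP i j) => // h.
    by have := lt_neq _ _ h jN.
  by have := lt_neq _ _ h iN; rewrite ij.
move=> ij jN eq_ij.
(* Applying [f] another [N - j] times moves the coincidence up to [N], so the iterate of index
   [N - j + i < N] is already fixed. *)
have eqN : iter (N - j + i) f x = iter N f x by rewrite iterD eq_ij -iterD subnK.
by apply: (minN (N - j + i)%N); [lia | rewrite iterS eqN -iterS].
Qed.

Theorem mainTheorem3 (R : realType) (n : nat) (P : expr n) (hP : CM R P) :
  exists N : nat,
    [/\ (1 <= N)%N,
        (forall i j : nat, (1 <= i <= N)%N -> (1 <= j <= N)%N ->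
           (P ^+ i)%g = (P ^+ j)%g -> i = j) &
        exists k : nat, (P * P ^+ N)%g = delta_scale k (P ^+ N)%g].
Proof.
have [pa planar_a] := hP; have ua := planar_unlinked pa planar_a.
pose c m := iter m (glued_pairs (pairs P)) (pairs P).
have ex_fix : exists m, c m.+1 == c m.
  by have [m cm] := iter_glued_stabilizes pa ua; exists m; apply/eqP.
have [N /eqP fixN minN] := ex_minnP ex_fix.
(* Iterate [N] is the pairing of the power [N.+1]. *)
exists N.+1; split=> // [i j|].
  case: i => // i; case: j => // j; rewrite !ltnS => iN jN.
  (* The powers are told apart by their pairings alone. *)
  move/(congr1 (@pairs n)); rewrite !pairs_exp => ij; congr _.+1.
  apply: iter_inj_before_fixed fixN _ _ iN jN ij => m mN cm.
  by have := minN m; rewrite leqNgt mN /c cm eqxx => /(_ isT).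
(* The exponent gained on multiplying by [P] on the left: that of [P] and the new loops. *)
exists (exponent P + loops (pairs P) (pairs (P ^+ N.+1)%g))%N.
rewrite -[LHS]/(expr_mul P (P ^+ N.+1)%g) /expr_mul /delta_scale; congr Expr.
  by rewrite addnAC.
by rewrite pairs_exp -iterS.
Qed.
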